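(* Let $\alpha,\beta\in\mathbb{R}$ with $\alpha\neq 0$, and let $(G_1,g,J)$ be the connected, simply connected three-dimensional Lorentzian Lie group with product structure $J$ whose Lie algebra $\mathfrak{g}$ has a pseudo-orthonormal basis $\{e_1,e_2,e_3\}$ ($e_3$ timelike) with $[e_1,e_2]=\alpha e_1-\beta e_3$, $[e_1,e_3]=-\alpha e_1-\beta e_2$, $[e_2,e_3]=\beta e_1+\alpha e_2+\alpha e_3$. Let $c\in\mathbb{R}$. Then $(G_1,g,J)$ is a second kind algebraic Ricci soliton associated to the Kobayashi-Nomizu connection $\nabla^1$ with constant $c$ if and only if $\frac{\alpha^2}{2}+c=0$, $\beta=0$, $\alpha\neq 0$. In particular, in that case $\widetilde{\mathrm{Ric}}^1(e_1)=-\alpha^2e_1$, $\widetilde{\mathrm{Ric}}^1(e_2)=-\alpha^2e_2-\frac{\alpha^2}{2}e_3$, $\widetilde{\mathrm{Ric}}^1(e_3)=\frac{\alpha^2}{2}e_2$, and $De_1=-\frac{\alpha^2}{2}e_1$, $De_2=-\frac{\alpha^2}{2}e_2-\frac{\alpha^2}{2}e_3$, $De_3=\frac{\alpha^2}{2}e_2+\frac{\alpha^2}{2}e_3$.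
   Context: The left-invariant Lorentzian metric $g$ satisfies $g(e_1,e_1)=g(e_2,e_2)=1$, $g(e_3,e_3)=-1$, $g(e_i,e_j)=0$ for $i\ne j$. All tensors and connections are left-invariant and evaluated on $\mathfrak{g}$. $\nabla$ is the Levi-Civita connection of $g$. The product structure is $Je_1=e_1$, $Je_2=e_2$, $Je_3=-e_3$, and $(\nabla_XJ)Y=\nabla_X(JY)-J(\nabla_XY)$. The canonical connection is $\nabla^0_XY=\nabla_XY-\frac12(\nabla_XJ)(JY)$ and the Kobayashi-Nomizu connection is $\nabla^1_XY=\nabla^0_XY-\frac14[(\nabla_YJ)(JX)-(\nabla_{JY}J)X]$, with curvature $R^1(X,Y)Z=\nabla^1_X\nabla^1_YZ-\nabla^1_Y\nabla^1_XZ-\nabla^1_{[X,Y]}Z$. Its Ricci tensor is $\rho^1(X,Y)=-g(R^1(X,e_1)Y,e_1)-g(R^1(X,e_2)Y,e_2)+g(R^1(X,e_3)Y,e_3)$; its symmetrization is $\widetilde\rho^1(X,Y)=\frac12(\rho^1(X,Y)+\rho^1(Y,X))$, and the operator $\widetilde{\mathrm{Ric}}^1$ is defined by $\widetilde\rho^1(X,Y)=g(\widetilde{\mathrm{Ric}}^1(X),Y)$. Second kind algebraic Ricci soliton associated to $\nabla^1$ with constant $c$ means: $\widetilde{\mathrm{Ric}}^1=c\,\mathrm{Id}+D$ where $D$ is a derivation of $\mathfrak{g}$, i.e. a linear map with $D[X,Y]=[DX,Y]+[X,DY]$ for all $X,Y\in\mathfrak{g}$. *)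

(* Defs.v *)
(* The Lie group is represented by its Lie algebra, a vectType over R,
   and left-invariant tensors and connections by multilinear maps on it. *)
From HB Require Import structures.
From mathcomp Require Import all_boot all_order all_algebra.
From mathcomp Require Import reals.

Set Implicit Arguments.
Unset Strict Implicit.
Unset Printing Implicit Defensive.

Import Order.TTheory GRing.Theory Num.Theory.
Local Open Scope ring_scope.

Record lieBracket (R : realFieldType) (V : vectType R) := LieBracket {
  lie_br :> {bilinear V -> V -> V};
  lie_alternating : forall x, lie_br x x = 0;
  lie_jacobi : forall x y z,
    lie_br x (lie_br y z) + lie_br y (lie_br z x) + lie_br z (lie_br x y) = 0
}.

Section Definitions.
Variables (R : realFieldType) (V : vectType R).
Variables (br : lieBracket V) (g : {symmetric V}).

Definition is_derivation (D : 'End(V)) : Prop :=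
  forall x y, D (br x y) = br (D x) y + br x (D y).

Definition pseudo_orthonormal_basis (e1 e2 e3 : V) : Prop :=
  [/\ basis_of fullv [:: e1; e2; e3],
      [/\ g e1 e1 = 1, g e2 e2 = 1 & g e3 e3 = -1]
    & [/\ g e1 e2 = 0, g e1 e3 = 0 & g e2 e3 = 0]].

(* For a left-invariant metric, g (Y, Z) is constant on left-invariant fields,
   so the term X (g (Y, Z)) of metric compatibility vanishes. *)
Definition is_levi_civita (nabla : {bilinear V -> V -> V}) : Prop :=
  (forall x y, nabla x y - nabla y x = br x y) /\
  (forall x y z, g (nabla x y) z + g y (nabla x z) = 0).

Definition is_product_structure (e1 e2 e3 : V) (J : 'End(V)) : Prop :=
  [/\ J e1 = e1, J e2 = e2 & J e3 = - e3].

(* [cov_endo nabla J X Y] is (nabla_X J) Y. *)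
Definition cov_endo (nabla : V -> V -> V) (J : 'End(V)) (x y : V) : V :=
  nabla x (J y) - J (nabla x y).

Definition canonical_connection (nabla : V -> V -> V) (J : 'End(V))
    (x y : V) : V :=
  nabla x y - 2^-1 *: cov_endo nabla J x (J y).

Definition kobayashi_nomizu (nabla : V -> V -> V) (J : 'End(V))
    (x y : V) : V :=
  canonical_connection nabla J x y
  - 4^-1 *: (cov_endo nabla J y (J x) - cov_endo nabla J (J y) x).

Definition curvature (conn : V -> V -> V) (x y z : V) : V :=
  conn x (conn y z) - conn y (conn x z) - conn (br x y) z.

Definition ricci (e1 e2 e3 : V) (conn : V -> V -> V) (x y : V) : R :=
  - g (curvature conn x e1 y) e1 - g (curvature conn x e2 y) e2
  + g (curvature conn x e3 y) e3.

Definition ricci_sym (e1 e2 e3 : V) (conn : V -> V -> V) (x y : V) : R :=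
  2^-1 * (ricci e1 e2 e3 conn x y + ricci e1 e2 e3 conn y x).

Definition is_ricci_sym_op (e1 e2 e3 : V) (conn : V -> V -> V)
    (Ric : 'End(V)) : Prop :=
  forall x y, ricci_sym e1 e2 e3 conn x y = g (Ric x) y.

(* [nabla] is meant to be the Levi-Civita connection of [g]. *)
Definition second_kind_soliton (e1 e2 e3 : V) (J : 'End(V))
    (nabla : V -> V -> V) (c : R) : Prop :=
  exists Ric D : 'End(V),
    [/\ is_ricci_sym_op e1 e2 e3 (kobayashi_nomizu nabla J) Ric,
        is_derivation D
      & Ric = c *: \1%VF + D].

End Definitions.

(* Main.v *)
(* The Koszul formula determines the Levi-Civita connection from the bracket,
   and non-degeneracy of g determines the Ricci operator from its symmetrized
   tensor; both are computed in coordinates with respect to e1, e2, e3.  The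
   derivation identity on the pair (e1, e2) has e2-component
   alpha ^+ 2 * beta / 2 = 0, so beta = 0, and its e1-component is then
   alpha * (alpha ^+ 2 / 2 + c) = 0. *)
Require Import Defs.
From HB Require Import structures.
From mathcomp Require Import all_boot all_order all_algebra.
From mathcomp Require Import reals.
From mathcomp Require Import ring lra.

Set Implicit Arguments.
Unset Strict Implicit.
Unset Printing Implicit Defensive.

Import Order.TTheory GRing.Theory Num.Theory.
Local Open Scope ring_scope.

(** * Symmetric forms, brackets and the Koszul formula *)

Lemma symmetric_formC (R : realFieldType) (V : vectType R)
  (g : {symmetric V}) (x y : V) : g x y = g y x.
(* For a symmetric form the sign in [hermC] is a power of -1 with exponent 0. *)
Proof. by rewrite hermC expr0 mul1r. Qed.

Lemma lie_brC (R : realFieldType) (V : vectType R) (br : lieBracket V)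
  (x y : V) : br x y = - br y x.
Proof.
have := lie_alternating br (x + y).
rewrite linearDl !linearDr /= !lie_alternating add0r addr0 => /eqP.
by rewrite addr_eq0 => /eqP.
Qed.

(** Torsion-freeness turns each bracket into a difference of covariant derivatives; the three cyclic
    instances of metric compatibility then cancel all terms but [g (nabla x y) z], up to the factor
    2. *)
Lemma koszul_formula (R : realFieldType) (V : vectType R)
  (br : lieBracket V) (g : {symmetric V}) (nabla : {bilinear V -> V -> V})
  (x y z : V) : is_levi_civita br g nabla ->
  g (nabla x y) z = 2^-1 * (g (br x y) z - g (br y z) x + g (br z x) y).
Proof.
case=> torsion_free metric.
rewrite -!torsion_free !linearBl /=.
have := metric x y z; have := metric y z x; have := metric z x y.
rewrite ![g y _]symmetric_formC ![g z _]symmetric_formC ![g x _]symmetric_formC.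
lra.
Qed.

(** * Coordinates in the pseudo-orthonormal basis *)

Section Frame.
Variables (R : realFieldType) (V : vectType R).
Variables (br : lieBracket V) (g : {symmetric V}) (e1 e2 e3 : V) (J : 'End(V)).
Variables (nabla : {bilinear V -> V -> V}) (alpha beta : R).
Hypothesis he : pseudo_orthonormal_basis g e1 e2 e3.

(** A [frame] term does not display the basis vectors, so rewriting them as frames leaves pure
    coordinates, and [congr frame] splits a vector identity into three scalar ones. *)
Definition frame (a b c : R) : V := a *: e1 + b *: e2 + c *: e3.

Lemma frame1 : e1 = frame 1 0 0.
Proof. by rewrite /frame scale1r !scale0r !addr0. Qed.

Lemma frame2 : e2 = frame 0 1 0.
Proof. by rewrite /frame scale1r !scale0r add0r addr0. Qed.

Lemma frame3 : e3 = frame 0 0 1.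
Proof. by rewrite /frame scale1r !scale0r !add0r. Qed.

Lemma frameD a b c a' b' c' :
  frame a b c + frame a' b' c' = frame (a + a') (b + b') (c + c').
Proof. by rewrite /frame !scalerDl addrACA [X in X + _]addrACA. Qed.

Lemma frameZ k a b c : k *: frame a b c = frame (k * a) (k * b) (k * c).
Proof. by rewrite /frame !scalerDr !scalerA. Qed.

Lemma frameN a b c : - frame a b c = frame (- a) (- b) (- c).
Proof. by rewrite /frame !scaleNr !opprD. Qed.

Definition frameE := (frameN, frameZ, frameD).

Lemma metric_frame a b c a' b' c' :
  g (frame a b c) (frame a' b' c') = a * a' + b * b' - c * c'.
Proof.
have [_ [g11 g22 g33] [g12 g13 g23]] := he.
rewrite /frame !linearDl !linearDr /= !linearZl_LR !linearZr_LR /=.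
rewrite (symmetric_formC g e2 e1) (symmetric_formC g e3 e1).
rewrite (symmetric_formC g e3 e2) g11 g22 g33 g12 g13 g23; ring.
Qed.

(** Spanning gives some coordinates, and pairing with the basis identifies them; the sign on the
    third comes from [g e3 e3 = -1]. *)
Lemma frame_coord v : v = frame (g v e1) (g v e2) (- g v e3).
Proof.
have [basis _ _] := he.
have [a [b [c ->]]] : exists a b c, v = frame a b c.
  have := memvf v; rewrite -(span_basis basis) !span_cons span_nil addv0.
  case/memv_addP=> _ /vlineP[a ->] [_ /memv_addP[_ /vlineP[b ->]
    [_ /vlineP[c ->] ->]] ->].
  by exists a, b, c; rewrite /frame addrA.
by rewrite frame1 frame2 frame3 !metric_frame; congr frame; ring.
Qed.

Lemma frame_inj a b c a' b' c' :
  frame a b c = frame a' b' c' -> [/\ a = a', b = b' & c = c'].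
Proof.
move=> eq_f; split.
- by have := congr1 (fun v => g v (frame 1 0 0)) eq_f; rewrite !metric_frame; lra.
- by have := congr1 (fun v => g v (frame 0 1 0)) eq_f; rewrite !metric_frame; lra.
- by have := congr1 (fun v => g v (frame 0 0 1)) eq_f; rewrite !metric_frame; lra.
Qed.

Lemma bilinear_frame (f : {bilinear V -> V -> V}) a b c a' b' c' :
  f (frame a b c) (frame a' b' c') =
    (a * a') *: f e1 e1 + (a * b') *: f e1 e2 + (a * c') *: f e1 e3
  + ((b * a') *: f e2 e1 + (b * b') *: f e2 e2 + (b * c') *: f e2 e3)
  + ((c * a') *: f e3 e1 + (c * b') *: f e3 e2 + (c * c') *: f e3 e3).
Proof.
rewrite /frame !linearDl !linearDr /= !linearZl_LR !linearZr_LR /=.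
by rewrite !scalerA.
Qed.

(** Reading coordinates off through [g] makes linearity of the map immediate. *)
Lemma exists_frame_endo (u1 u2 u3 : V) :
  exists F : 'End(V),
    forall a b c, F (frame a b c) = a *: u1 + b *: u2 + c *: u3.
Proof.
pose f v := g v e1 *: u1 + g v e2 *: u2 - g v e3 *: u3.
have f_linear : linear f.
  move=> k u v; rewrite /f !linearDl /= !linearZl_LR /= !scalerDl -!scalerA.
  rewrite !scalerDr scalerN opprD.
  by rewrite [RHS]addrACA [X in X + _ = _]addrACA.
pose fL := HB.pack f (GRing.isLinear.Build R V V *:%R f f_linear)
  : {linear V -> V}.
exists (linfun fL) => a b c; rewrite lfunE /= /f.
rewrite frame1 frame2 frame3 !metric_frame -scaleNr.
by congr (_ *: _ + _ *: _ + _ *: _); ring.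
Qed.

(** * Bracket, connections and Ricci tensor in coordinates *)

Hypothesis h12 : br e1 e2 = alpha *: e1 - beta *: e3.
Hypothesis h13 : br e1 e3 = - alpha *: e1 - beta *: e2.
Hypothesis h23 : br e2 e3 = beta *: e1 + alpha *: e2 + alpha *: e3.
Hypothesis hJ : is_product_structure e1 e2 e3 J.
Hypothesis hnabla : is_levi_civita br g nabla.

Lemma product_frame a b c : J (frame a b c) = frame a b (- c).
Proof.
by case: hJ => J1 J2 J3; rewrite !linearD !linearZ /= J1 J2 J3 scalerN -scaleNr.
Qed.

(** Alternation kills the diagonal terms of [bilinear_frame] and pairs the others, so only 2x2
    minors of the coordinates remain. *)
Lemma bracket_frame a b c a' b' c' :
  br (frame a b c) (frame a' b' c') =
  frame (alpha * (a * b' - b * a') - alpha * (a * c' - c * a')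
          + beta * (b * c' - c * b'))
        (- beta * (a * c' - c * a') + alpha * (b * c' - c * b'))
        (- beta * (a * b' - b * a') + alpha * (b * c' - c * b')).
Proof.
have b12 : br e1 e2 = frame alpha 0 (- beta).
  by rewrite h12 /frame scale0r addr0 scaleNr.
have b13 : br e1 e3 = frame (- alpha) (- beta) 0.
  by rewrite h13 /frame scale0r addr0 [- beta *: _]scaleNr.
have b23 : br e2 e3 = frame beta alpha alpha by rewrite h23.
rewrite bilinear_frame !lie_alternating !scaler0 add0r addr0 addr0.
rewrite (lie_brC br e2 e1) (lie_brC br e3 e1) (lie_brC br e3 e2) b12 b13 b23.
by rewrite !frameE; congr frame; ring.
Qed.

Lemma levi_civita_frame a b c a' b' c' :
  nabla (frame a b c) (frame a' b' c') =
  frame (alpha * a * b' - alpha * a * c' + beta / 2 * (b * c' - c * b'))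
        (- alpha * a * a' + beta / 2 * (c * a' - a * c')
          + alpha * (b * c' - c * c'))
        (- alpha * a * a' + beta / 2 * (b * a' - a * b')
          + alpha * (b * b' - c * b')).
Proof.
rewrite [LHS]frame_coord !(koszul_formula _ _ _ hnabla).
rewrite frame1 frame2 frame3 !bracket_frame !metric_frame.
by congr frame; field.
Qed.

(** The first two coordinates involve only [a'] and [b'], the third only [c']: this connection
    commutes with [J]. *)
Lemma kobayashi_nomizu_frame a b c a' b' c' :
  kobayashi_nomizu nabla J (frame a b c) (frame a' b' c') =
  frame (alpha * a * b' + alpha * c * a' - beta * c * b')
        (- alpha * a * a' + beta * c * a' - alpha * c * b')
        (alpha * b * c').
Proof.
rewrite /kobayashi_nomizu /canonical_connection /cov_endo.
rewrite !product_frame !levi_civita_frame !product_frame !frameE.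
by congr frame; field.
Qed.

(** There is no [c * c'] term: the curvature maps [e3] into its own line, which is orthogonal to
    [e1] and [e2], and it vanishes on the pair [(e3, e3)]. *)
Lemma ricci_sym_frame a b c a' b' c' :
  ricci_sym br g e1 e2 e3 (kobayashi_nomizu nabla J)
    (frame a b c) (frame a' b' c') =
  - (alpha ^+ 2 + beta ^+ 2) * (a * a' + b * b')
  + alpha * beta * (a * b' + b * a') - alpha * beta / 2 * (a * c' + c * a')
  + alpha ^+ 2 / 2 * (b * c' + c * b').
Proof.
rewrite /ricci_sym /ricci /curvature frame1 frame2 frame3.
rewrite !bracket_frame !kobayashi_nomizu_frame !frameE !metric_frame.
by field.
Qed.

(** Raising the index with [g] negates the third row of the symmetric matrix of
    [ricci_sym_frame]. *)
Lemma ricci_sym_opE Ric :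
  is_ricci_sym_op br g e1 e2 e3 (kobayashi_nomizu nabla J) Ric ->
  forall a b c, Ric (frame a b c) =
    frame (- (alpha ^+ 2 + beta ^+ 2) * a + alpha * beta * b
            - alpha * beta / 2 * c)
          (alpha * beta * a - (alpha ^+ 2 + beta ^+ 2) * b
            + alpha ^+ 2 / 2 * c)
          (alpha * beta / 2 * a - alpha ^+ 2 / 2 * b).
Proof.
move=> RicP a b c; rewrite [LHS]frame_coord frame1 frame2 frame3 -!RicP.
by rewrite !ricci_sym_frame; congr frame; field.
Qed.

Lemma exists_ricci_sym_op : exists Ric,
  is_ricci_sym_op br g e1 e2 e3 (kobayashi_nomizu nabla J) Ric.
Proof.
(* The prescribed images are the columns of the matrix in [ricci_sym_opE]. *)
have [Ric RicE] := exists_frame_endo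
  (frame (- (alpha ^+ 2 + beta ^+ 2)) (alpha * beta) (alpha * beta / 2))
  (frame (alpha * beta) (- (alpha ^+ 2 + beta ^+ 2)) (- (alpha ^+ 2 / 2)))
  (frame (- (alpha * beta / 2)) (alpha ^+ 2 / 2) 0).
exists Ric => x y; rewrite (frame_coord x) (frame_coord y) RicE !frameE.
by rewrite ricci_sym_frame metric_frame; field.
Qed.

(** * The soliton equation *)

Lemma soliton_param (c : R) : alpha != 0 ->
  second_kind_soliton br g e1 e2 e3 J nabla c ->
  alpha ^+ 2 / 2 + c = 0 /\ beta = 0.
Proof.
move=> halpha [Ric [D [/ricci_sym_opE RicE derD RicD]]].
have DE v : D v = Ric v - c *: v.
  by rewrite RicD add_lfunE scale_lfunE id_lfunE addrC addKr.
have := derD (frame 1 0 0) (frame 0 1 0).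
rewrite !bracket_frame !DE !RicE !frameE !bracket_frame !frameE.
case/frame_inj=> eq1 eq2 _.
have beta0 : beta = 0.
  have : alpha ^+ 2 * beta = 0 by move: eq2; lra.
  by move/eqP; rewrite mulf_eq0 expf_eq0 (negPf halpha) => /eqP.
(* The goal is multiplied by [alpha] to match [eq1], which is cubic in [alpha]. *)
split=> //; apply: (mulfI halpha); move: eq1; rewrite beta0; lra.
Qed.

Lemma soliton_of_param (c : R) : alpha ^+ 2 / 2 + c = 0 -> beta = 0 ->
  second_kind_soliton br g e1 e2 e3 J nabla c.
Proof.
move=> hc beta0; have [Ric RicP] := exists_ricci_sym_op.
have RicE := ricci_sym_opE RicP.
have -> : c = - (alpha ^+ 2 / 2) by lra.
(* The soliton equation forces this [D], so the content is its derivation property, a polynomial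
   identity in [alpha] and the coordinates once [beta] is 0. *)
exists Ric, (Ric - (- (alpha ^+ 2 / 2)) *: \1%VF); split=> //; last first.
  by rewrite addrC subrK.
move=> x y; rewrite !add_lfunE !opp_lfunE !scale_lfunE !id_lfunE.
rewrite (frame_coord x) (frame_coord y) !bracket_frame !RicE !frameE.
rewrite !bracket_frame !frameE beta0.
by congr frame; field.
Qed.

Lemma ricci_op_value Ric : beta = 0 ->
  is_ricci_sym_op br g e1 e2 e3 (kobayashi_nomizu nabla J) Ric ->
  [/\ Ric e1 = - alpha ^+ 2 *: e1,
      Ric e2 = - alpha ^+ 2 *: e2 - (alpha ^+ 2 / 2) *: e3
    & Ric e3 = (alpha ^+ 2 / 2) *: e2].
Proof.
move=> beta0 /ricci_sym_opE RicE; rewrite frame1 frame2 frame3 !RicE !frameE.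
by rewrite beta0; split; congr frame; field.
Qed.
End Frame.

Theorem theorem2p11 (R : realType) (V : vectType R)
    (br : lieBracket V) (g : {symmetric V}) (e1 e2 e3 : V) (J : 'End(V))
    (nabla : {bilinear V -> V -> V}) (alpha beta c : R)
    (halpha : alpha != 0)
    (he : pseudo_orthonormal_basis g e1 e2 e3)
    (h12 : br e1 e2 = alpha *: e1 - beta *: e3)
    (h13 : br e1 e3 = - alpha *: e1 - beta *: e2)
    (h23 : br e2 e3 = beta *: e1 + alpha *: e2 + alpha *: e3)
    (hJ : is_product_structure e1 e2 e3 J)
    (hnabla : is_levi_civita br g nabla) :
  (second_kind_soliton br g e1 e2 e3 J nabla c <->
     [/\ alpha ^+ 2 / 2 + c = 0, beta = 0 & alpha != 0]) /\
  ([/\ alpha ^+ 2 / 2 + c = 0, beta = 0 & alpha != 0] ->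
     forall Ric : 'End(V),
     is_ricci_sym_op br g e1 e2 e3 (kobayashi_nomizu nabla J) Ric ->
     [/\ Ric e1 = - alpha ^+ 2 *: e1,
         Ric e2 = - alpha ^+ 2 *: e2 - (alpha ^+ 2 / 2) *: e3
       & Ric e3 = (alpha ^+ 2 / 2) *: e2] /\
     (forall D : 'End(V), is_derivation br D -> Ric = c *: \1%VF + D ->
       [/\ D e1 = - (alpha ^+ 2 / 2) *: e1,
           D e2 = - (alpha ^+ 2 / 2) *: e2 - (alpha ^+ 2 / 2) *: e3
         & D e3 = (alpha ^+ 2 / 2) *: e2 + (alpha ^+ 2 / 2) *: e3])).
Proof.
split; first split.
- by case/(soliton_param he h12 h13 h23 hJ hnabla halpha).
- by case=> hc beta0 _; exact: (soliton_of_param he h12 h13 h23 hJ hnabla).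
case=> hc beta0 _ Ric RicP.
have RicV := ricci_op_value he h12 h13 h23 hJ hnabla beta0 RicP.
split=> // D _ RicD; have [Ric1 Ric2 Ric3] := RicV.
(* The soliton equation gives [D] as [Ric] minus [c] times the identity, and [- c] is
   [alpha ^+ 2 / 2]. *)
have DE v : D v = Ric v + (alpha ^+ 2 / 2) *: v.
  have -> : alpha ^+ 2 / 2 = - c by lra.
  by rewrite RicD add_lfunE scale_lfunE id_lfunE scaleNr addrC addKr.
rewrite !DE Ric1 Ric2 Ric3; split.
- by rewrite -scalerDl; congr (_ *: _); field.
- by rewrite addrAC -scalerDl; congr (_ *: _ - _); field.
- by [].
Qed.
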